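(* Let $\pi^{(\ell)}$, $\ell=1,\dots,L$, be probability laws on $\{1,\dots,M\}$ with weights $w_\ell\ge0$, $\sum_\ell w_\ell=1$. Let $\phi^{(\ell)}:=\psi_{\pi^{(\ell)}}/\|\psi_{\pi^{(\ell)}}\|$ be the normalised register lifts of the component laws, let $\rho^{E}_0=\sum_\ell w_\ell\,\phi^{(\ell)}(\phi^{(\ell)})^{T}$ be the associated normalised pseudo-mixture, let $\mathcal{G}$ be the overlap matrix $\mathcal{G}_{\ell m}=\kappa(\pi^{(\ell)},\pi^{(m)})$, where $\kappa(p,q)=\langle\psi_p,\psi_q\rangle/(\|\psi_p\|\,\|\psi_q\|)$ is the $\chi^{2}$ overlap, and let $\mathsf{w}=\mathrm{diag}(w_\ell)$. Then the nonzero spectrum of $\rho^{E}_0$ equals the nonzero spectrum of the weighted overlap matrix $G=\mathsf{w}^{1/2}\mathcal{G}\,\mathsf{w}^{1/2}$. Moreover the entire characteristic polynomial of $\rho^{E}_z$, and every power trace $\mathrm{Tr}[(\rho^{E}_z)^{k}]$, $k\ge1$, is conserved along the whole flow $z\in\mathbb{C}$.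
   Context: Let $M\ge 2$ and let $Q=(Q_{ij})_{1\le i,j\le M}$ be the generator of an irreducible continuous-time Markov chain: $Q_{ij}\ge0$ for $i\neq j$ and $Q_{ii}=-\sum_{j\ne i}Q_{ij}$. Let $\nu$ be its unique stationary probability vector (strictly positive, $Q^{T}\nu=0$), and assume reversibility (detailed balance): $\nu_iQ_{ij}=\nu_jQ_{ji}$ for all $i,j$. Fix $\Lambda>0$ with $\Lambda\ge\max_i(-Q_{ii})$ and set $P:=\mathrm{I}+\tfrac1\Lambda Q$, $D:=\mathrm{diag}(\sqrt{\nu_1},\dots,\sqrt{\nu_M})$, $A:=DPD^{-1}$ (real symmetric by reversibility), $K:=\begin{pmatrix}0&-iA\\ iA&0\end{pmatrix}\in\mathbb{C}^{2M\times2M}$, $W_z:=e^{zK}$. The register lift (pseudo-wave map) of a law $p$ is $\psi_p:=D^{-1}p=(p_i/\sqrt{\nu_i})_i\in\mathbb{R}^{M}$; $\langle\cdot,\cdot\rangle$ and $\|\cdot\|$ are Euclidean. The doubled lift of component $\ell$ at $z=0$ is $\Phi^{(\ell)}_0=\binom{\phi^{(\ell)}}{0}\in\mathbb{C}^{2M}$ (normalised), $\Phi^{(\ell)}_z=W_z\Phi^{(\ell)}_0$, and the pseudo-mixed state is $\rho^{E}_z=\sum_\ell w_\ell\,\Phi^{(\ell)}_z(\Phi^{(\ell)}_z)^{T}\in\mathbb{C}^{2M\times2M}$ (plain transpose). At $z=0$ the doubled $\rho^{E}_0$ differs from the register form $\sum_\ell w_\ell\,\phi^{(\ell)}(\phi^{(\ell)})^{T}$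 only by blocks of zeros and has the same nonzero spectrum; the register form is used for the statement at $z=0$. *)

(* Defs.v *)
From HB Require Import structures.
From mathcomp Require Import all_boot all_order all_algebra.
From mathcomp Require Import complex.
From mathcomp Require Import all_classical all_reals all_analysis.

Set Implicit Arguments.
Unset Strict Implicit.
Unset Printing Implicit Defensive.

Import Order.TTheory GRing.Theory Num.Theory.
Import numFieldNormedType.Exports.

Local Open Scope classical_set_scope.
Local Open Scope ring_scope.

(* The library has no matrix exponential.  The limit is taken for the
   entrywise topology of 'M[C]_n. *)
Definition expmx (C : numFieldType) (n : nat) (X : 'M[C]_n) : 'M[C]_n :=
  limn (series (fun k : nat => k`!%:R^-1 *: X ^+ k)).

Definition algebraic_multiplicity (F : fieldType) (n : nat) (X : 'M[F]_n)
  (lambda : F) : nat := mup lambda (char_poly X).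

(* The sizes of X and Y may differ: only the multiplicity of 0 is left free. *)
Definition same_nonzero_spectrum (F : fieldType) (m n : nat)
    (X : 'M[F]_m) (Y : 'M[F]_n) : Prop :=
  forall lambda : F, lambda != 0 ->
    eigenvalue X lambda = eigenvalue Y lambda /\
    algebraic_multiplicity X lambda = algebraic_multiplicity Y lambda.

Section Chain.
Variables (R : realType) (M : nat).
Implicit Types (Q : 'M[R]_M) (nu p q : 'cV[R]_M) (Lambda : R).

Definition is_generator Q : Prop :=
  (forall i j, i != j -> 0 <= Q i j) /\
  (forall i, Q i i = - \sum_(j | j != i) Q i j).

Definition irreducible_generator Q : Prop :=
  forall i j, connect [rel k l | 0 < Q k l] i j.

Definition is_law p : Prop := (forall i, 0 <= p i 0) /\ \sum_i p i 0 = 1.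

Definition is_stationary Q nu : Prop := is_law nu /\ Q^T *m nu = 0.

Definition is_reversible Q nu : Prop :=
  forall i j, nu i 0 * Q i j = nu j 0 * Q j i.

Definition uniformised Q Lambda : 'M[R]_M := 1%:M + Lambda^-1 *: Q.

Definition sqrt_diag nu : 'M[R]_M := diag_mx (\row_i Num.sqrt (nu i 0)).

Definition symmetrised Q Lambda nu : 'M[R]_M :=
  sqrt_diag nu *m uniformised Q Lambda *m invmx (sqrt_diag nu).

(* The library norm `|u| on column vectors is the sup norm, hence the explicit
   Euclidean structure. *)
Definition inner p q : R := \sum_i p i 0 * q i 0.
Definition enorm p : R := Num.sqrt (inner p p).

Definition register_lift nu p : 'cV[R]_M := invmx (sqrt_diag nu) *m p.

Definition normalised_lift nu p : 'cV[R]_M :=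
  (enorm (register_lift nu p))^-1 *: register_lift nu p.

Definition chi2_overlap nu p q : R :=
  inner (register_lift nu p) (register_lift nu q) /
  (enorm (register_lift nu p) * enorm (register_lift nu q)).

Definition doubled_generator Q Lambda nu : 'M[R[i]]_(M + M) :=
  let A := map_mx (real_complex R) (symmetrised Q Lambda nu) in
  block_mx 0 (- ('i%C *: A)) ('i%C *: A) 0.

Definition wave_flow Q Lambda nu (z : R[i]) : 'M[R[i]]_(M + M) :=
  expmx (z *: doubled_generator Q Lambda nu).

Definition doubled_lift Q Lambda nu (z : R[i]) p : 'cV[R[i]]_(M + M) :=
  wave_flow Q Lambda nu z *m
    col_mx (map_mx (real_complex R) (normalised_lift nu p)) 0.

Section Mixture.
Variables (L : nat) (w : 'I_L -> R) (pi_ : 'I_L -> 'cV[R]_M).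

Definition register_mixture nu : 'M[R]_M :=
  \sum_l w l *: (normalised_lift nu (pi_ l) *m (normalised_lift nu (pi_ l))^T).

(* Plain transpose, not the conjugate transpose. *)
Definition doubled_mixture Q Lambda nu (z : R[i]) : 'M[R[i]]_(M + M) :=
  \sum_l real_complex R (w l) *:
    (doubled_lift Q Lambda nu z (pi_ l) *m
     (doubled_lift Q Lambda nu z (pi_ l))^T).

Definition overlap_matrix nu : 'M[R]_L :=
  \matrix_(l, m) chi2_overlap nu (pi_ l) (pi_ m).

Definition weighted_overlap_matrix nu : 'M[R]_L :=
  let sqrt_w := diag_mx (\row_l Num.sqrt (w l)) in
  sqrt_w *m overlap_matrix nu *m sqrt_w.

End Mixture.
End Chain.

(* Main.v *)
Require Import Defs.
From HB Require Import structures.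
From mathcomp Require Import all_boot all_order all_algebra.
From mathcomp Require Import complex.
From mathcomp Require Import ring.
From mathcomp Require Import all_classical all_reals all_analysis.

Set Implicit Arguments.
Unset Strict Implicit.
Unset Printing Implicit Defensive.

Import Order.TTheory GRing.Theory Num.Theory.
Import numFieldNormedType.Exports.

Local Open Scope ring_scope.

(** Both claims are about rank-one sums that can be factored.

    Spectrum at time zero.  Let B be the M x L matrix whose l-th column is
    sqrt (w l) times the normalised lift of the l-th law.  The register mixture
    is B *m B^T and the weighted overlap matrix is B^T *m B.  Two products of
    rectangular matrices taken in opposite orders have characteristic
    polynomials that agree up to powers of 'X ([char_poly_mulmxC]), hence the
    same nonzero eigenvalues with the same algebraic multiplicities.

    Conservation.  Detailed balance makes A = D P D^-1 symmetric, so the doubled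
    generator K, with off-diagonal blocks -iA and iA, satisfies K^T = - K for
    the plain transpose ([doubled_generator_tr]).  Therefore W = exp (z K) is
    complex orthogonal, W^T W = exp (- z K) exp (z K) = 1, for every complex z
    ([wave_flow_orthogonal]).  Pulling W out of the sum, the mixture at z is
    W rho W^T = W rho W^-1 with rho independent of z ([doubled_mixture_conj]), so
    its characteristic polynomial and power traces do not depend on z.

    The analytic content is exp (- X) exp (X) = 1 for a complex matrix exponential
    defined as the limit of its partial sums ([expmxNK]).  For commuting x and y,
    the product of the n-th partial sums at x and y is the n-th partial sum at
    x + y plus a sum over the corner i, j < n <= i + j ([exp_trunc_mul]).  When the
    entries of X^k are at most c^k in modulus, the corner sum for - X and X is
    dominated entrywise by the corner sum for the scalars c and c, which is
    S_n(c)^2 - S_n(2c) and tends to exp(c)^2 - exp(2c) = 0. *)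

(** * Characteristic polynomials of products *)

(** Let N have the block rows ('X, B) and (C, 1).  Clearing C with the identity
    block shows that its determinant is the characteristic polynomial of B *m C.
    Scaling the second block row by 'X and clearing C with the first one shows that
    'X ^+ n times this determinant is 'X ^+ m times the one of C *m B. *)
Lemma char_poly_mulmxC (R : comNzRingType) m n (B : 'M[R]_(m, n))
    (C : 'M[R]_(n, m)) :
  'X ^+ n * char_poly (B *m C) = 'X ^+ m * char_poly (C *m B).
Proof.
rewrite /char_poly /char_poly_mx !map_mxM /=.
move: (map_mx polyC B) (map_mx polyC C) => b c.
pose N := block_mx ('X%:M : 'M[_]_m) b c (1%:M : 'M[_]_n).
have detN : \det N = \det ('X%:M - b *m c).
  have := det_mulmx N (block_mx 1%:M 0 (- c) 1%:M).
  rewrite mulmx_block !mulmx1 !mulmx0 !mul1mx !add0r mulmxN subrr.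
  by rewrite det_ublock det_lblock !det1 !mulr1.
have := det_mulmx (block_mx 1%:M 0 (- c) ('X%:M : 'M[_]_n)) N.
rewrite mulmx_block !mul1mx !mul0mx !addr0 mulmx1 mul_mx_scalar mul_scalar_mx.
rewrite scalerN addNr det_ublock det_lblock !det_scalar expr1n mul1r detN.
by rewrite mulNmx addrC => ->.
Qed.

(** Powers of 'X do not vanish at a nonzero point, so they do not contribute to
    the multiplicity of a nonzero root. *)
Lemma same_nonzero_spectrum_mulmxC (F : fieldType) m n (B : 'M[F]_(m, n))
    (C : 'M[F]_(n, m)) : same_nonzero_spectrum (B *m C) (C *m B).
Proof.
move=> x x0.
have charNz k (N : 'M[F]_k) : char_poly N != 0.
  exact/monic_neq0/char_poly_monic.
have Xroot k : ~~ root ('X ^+ k : {poly F}) x by rewrite /root hornerXn expf_neq0.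
have mupE : mup x (char_poly (B *m C)) = mup x (char_poly (C *m B)).
  by rewrite -(mupMr _ (Xroot n)) char_poly_mulmxC mupMr.
split=> //.
by rewrite !eigenvalue_root_char -!dvdp_XsubCl !XsubC_dvd // mupE.
Qed.

(** Moving W to the right end with [char_poly_mulmxC] costs no power of 'X when
    the matrices are square. *)
Lemma char_poly_conj (F : fieldType) n (W V X : 'M[F]_n) :
  V *m W = 1%:M -> char_poly (W *m X *m V) = char_poly X.
Proof.
move=> VW.
apply: (@mulfI _ ('X ^+ n)); first by rewrite expf_neq0 ?polyX_eq0.
by rewrite -mulmxA char_poly_mulmxC -mulmxA VW mulmx1.
Qed.

Lemma mxtrace_expr_conj (F : fieldType) n (W V X : 'M[F]_n) k :
  V *m W = 1%:M -> \tr ((W *m X *m V) ^+ k) = \tr (X ^+ k).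
Proof.
move=> VW; suff -> : (W *m X *m V) ^+ k = W *m X ^+ k *m V.
  by rewrite mxtrace_mulC mulmxA VW mul1mx.
elim: k => [|k IHk]; first by rewrite !expr0 mulmx1 (mulmx1C VW).
rewrite !exprS IHk -!mulmxE -!mulmxA; congr (_ *m (_ *m _)).
by rewrite mulmxA VW mul1mx.
Qed.

(** * Partial sums of the exponential series *)

Definition exp_trunc (F : numFieldType) (A : algType F) (x : A) (n : nat) : A :=
  \sum_(i < n) i`!%:R^-1 *: x ^+ i.

(** By the binomial formula, the partial sum at x + y collects exactly the terms
    with i + j < n of the product of the partial sums at x and y.  The corner
    i, j < n <= i + j that is left over is kept explicit, so that the corner of one
    algebra can be compared with that of another. *)
Lemma exp_trunc_mul (F : numFieldType) (A : algType F) (x y : A) n :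
  GRing.comm x y ->
  exp_trunc x n * exp_trunc y n = exp_trunc (x + y) n +
  \sum_(i < n) \sum_(n - i <= j < n)
     (i`!%:R^-1 * j`!%:R^-1) *: (x ^+ i * y ^+ j).
Proof.
move=> xy; set f := fun i j : nat =>
  (i`!%:R^-1 * j`!%:R^-1) *: (x ^+ i * y ^+ j).
have -> : exp_trunc (x + y) n = \sum_(i < n) \sum_(0 <= j < n - i) f i j.
  (* Going from n to n.+1 adds the antidiagonal i + j = n to the triangle. *)
  rewrite /exp_trunc; elim: n => [|n IHn]; first by rewrite !big_ord0.
  rewrite big_ord_recr /= IHn [RHS]big_ord_recr /= subSnn big_nat1.
  transitivity (\sum_(i < n) \sum_(0 <= j < n - i) f i j
                + \sum_(i < n.+1) f i (n - i)%N); last first.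
    rewrite big_ord_recr /= subnn addrA -big_split /=; congr (_ + _).
    by apply: eq_bigr => i _; rewrite subSn ?(ltnW (ltn_ord i))// big_nat_recr.
  congr (_ + _); rewrite (addrC x) (exprDn_comm _ (commr_sym xy)).
  rewrite scaler_sumr; apply: eq_bigr => i _.
  rewrite /f -[_ *+ 'C(_, _)]scaler_nat scalerA.
  have le_in : (i <= n)%N by rewrite -ltnS.
  rewrite (commrX _ (commr_sym (commrX _ xy))); congr (_ *: _).
  rewrite -(bin_fact le_in) !natrM !invfM.
  have nz k : (k`!%:R : F) != 0 by rewrite pnatr_eq0 -lt0n fact_gt0.
  have cz : ('C(n, i)%:R : F) != 0 by rewrite pnatr_eq0 -lt0n bin_gt0.
  by rewrite mulrAC mulVf // mul1r.
rewrite /exp_trunc big_distrlr -big_split /=; apply: eq_bigr => i _.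
rewrite -big_cat_nat ?leq_subr //= big_mkord; apply: eq_bigr => j _.
by rewrite -scalerAl -scalerAr scalerA.
Qed.

Local Open Scope classical_set_scope.

(** * Convergence of complex matrices and series *)

Lemma cvg_mx_coord (C : numFieldType) m n (u : nat -> 'M[C]_(m, n))
    (U : 'M[C]_(m, n)) :
  (forall i j, u k i j @[k --> \oo] --> U i j) -> u k @[k --> \oo] --> U.
Proof.
move=> uU A [P UP PA].
have near_row i : \forall k \near \oo, forall j, P i j (u k i j).
  by apply: filter_forall => j; exact: (uU i j _ (UP i j)).
by apply: filterS (filter_forall _ near_row) => k Pk; apply: PA => i j; exact: Pk.
Qed.

Lemma norm_dominated_cvg0 (C : numFieldType) (V : pseudoMetricNormedZmodType C)
    (u : nat -> V) (v : nat -> C) :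
  (forall k, `|u k| <= v k) -> v k @[k --> \oo] --> (0 : C) ->
  u k @[k --> \oo] --> (0 : V).
Proof.
move=> uv /cvgr0Pnorm_le v0; apply/cvgr0Pnorm_le => e /v0.
apply: filterS => k vke; apply: le_trans (uv k) (le_trans _ vke).
by rewrite ger0_norm // (le_trans _ (uv k)).
Qed.

(** The complex numbers seen as a numFieldType: the topology given by the modulus
    is inferred from this structure, not from the bare type R[i]. *)
Definition complex_num (R : realType) : numFieldType := R[i].

(** The embedding of the reals, with the topological type as codomain. *)
Definition creal (R : realType) : {rmorphism R -> complex_num R} := real_complex R.
Arguments creal {R}.

Lemma cvg_real_complex (R : realType) (v : nat -> R) (l : R) :
  v k @[k --> \oo] --> l ->
  creal (v k) @[k --> \oo] --> (creal l : complex_num R).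
Proof.
move=> /cvgrPdist_le vl; apply/cvgrPdist_le => -[e e'].
rewrite ltcE /= => /andP[/eqP -> e0].
have := vl _ e0; apply: filterS => k.
by rewrite -rmorphB normc_def /= expr0n addr0 sqrtr_sqr lecR.
Qed.

(** Completeness is only used on the real line: the real and imaginary parts are
    both dominated by the modulus, so each of their series converges absolutely. *)
Lemma is_cvg_complex_series (R : realType) (u : nat -> complex_num R)
    (v : nat -> R) :
  (forall k, `|u k| <= creal (v k)) -> cvgn (series v) ->
  cvgn (series u).
Proof.
move=> uv cv.
have v0 k : 0 <= v k.
  by have := le_trans (normr_ge0 _) (uv k); rewrite lecE /= => /andP[].
have part (f : R[i] -> R) : (forall z, (`|f z|%:C)%C <= `|z|) ->
    cvgn (series (f \o u)).
  move=> f_le; apply: normed_cvg; apply: series_le_cvg cv => //= k.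
  by rewrite -lecR (le_trans (f_le _)).
have /cvg_ex[a cva] := part (@complex.Re R) (@complex.normc_ge_Re R).
have Im_le (z : R[i]) : (`|complex.Im z|%:C)%C <= `|z|.
  by rewrite normc_def lecR -sqrtr_sqr ler_wsqrtr // lerDr sqr_ge0.
have /cvg_ex[b cvb] := part (@complex.Im R) Im_le.
apply/cvg_ex; exists (creal a + 'i%C * creal b).
have -> : series u = (fun n => creal (series (fun k => complex.Re (u k)) n)
     + 'i%C * creal (series (fun k => complex.Im (u k)) n)).
  apply/funext => n; rewrite /series /= !rmorph_sum mulr_sumr -big_split /=.
  by apply: eq_bigr => k _; exact: complexE.
apply: cvgD; first exact: cvg_real_complex cva.
by apply: cvgM; [exact: cvg_cst | exact: cvg_real_complex cvb].
Qed.

(** The sum of the moduli of all entries dominates every row sum, so it bounds the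
    entries of the powers inductively.  A pure power of c, without dimension factor,
    makes the comparison with the scalar exponential series exact. *)
Lemma expr_mx_bound (C : numFieldType) n (X : 'M[C]_n) :
  exists2 c : C, 0 <= c & forall k i j, `|(X ^+ k) i j| <= c ^+ k.
Proof.
exists (\sum_i \sum_j `|X i j|); first by do 2 apply: sumr_ge0 => ? _.
set c := \sum_i _; elim=> [|k IHk] i j.
  by rewrite !expr0 mxE; case: (i == j); rewrite ?normr1 ?normr0.
rewrite !exprS -mulmxE mxE (le_trans (ler_norm_sum _ _ _)) //.
apply: (@le_trans _ _ ((\sum_l `|X i l|) * c ^+ k)).
  by rewrite mulr_suml ler_sum // => l _; rewrite normrM ler_wpM2l.
apply: ler_wpM2r; first by apply: exprn_ge0; do 2 apply: sumr_ge0 => ? _.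
by rewrite /c [leRHS](bigD1 i) //= lerDl; do 2 apply: sumr_ge0 => ? _.
Qed.

(** * The complex matrix exponential *)

Lemma exp_trunc_complex (R : realType) (r : R) n :
  exp_trunc (creal r : (complex_num R)^o) n =
  creal (series (exp_coeff r) n).
Proof.
rewrite /exp_trunc /series /= rmorph_sum big_mkord; apply: eq_bigr => k _.
rewrite /exp_coeff /= rmorphM rmorphXn fmorphV rmorph_nat.
exact: mulrC.
Qed.

Lemma cvg_exp_trunc_complex (R : realType) (r : R) :
  exp_trunc (creal r : (complex_num R)^o) n @[n --> \oo] -->
  (creal (expR r) : complex_num R).
Proof.
under eq_fun do rewrite exp_trunc_complex.
exact/cvg_real_complex/is_cvg_series_exp_coeff.
Qed.

(** [expmx] is a limit that is a priori arbitrary if the series diverges; entrywise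
    comparison with the exponential series of a real bound rules this out. *)
Lemma is_cvg_expmx (R : realType) n (X : 'M[complex_num R]_n) :
  series (fun k => k`!%:R^-1 *: X ^+ k) N @[N --> \oo] --> expmx X.
Proof.
suff [U cvU] : exists U : 'M[complex_num R]_n,
    series (fun k => k`!%:R^-1 *: X ^+ k) N @[N --> \oo] --> U.
  by apply/cvg_ex; exists U.
have [c] := expr_mx_bound X.
case: c => r r'; rewrite lecE /= => /andP[/eqP -> r0] Xr.
exists (\matrix_(i, j) limn (series (fun k => k`!%:R^-1 * (X ^+ k) i j))).
apply: cvg_mx_coord => i j; rewrite mxE.
have -> : (fun N => series (fun k => k`!%:R^-1 *: X ^+ k) N i j) =
    series (fun k => k`!%:R^-1 * (X ^+ k) i j).
  by apply/funext => N; rewrite /series /= summxE; apply: eq_bigr => k; rewrite mxE.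
apply: (is_cvg_complex_series _ (is_cvg_series_exp_coeff r)) => k.
rewrite normrM normfV normr_nat /exp_coeff /= rmorphM rmorphXn fmorphV rmorph_nat.
by rewrite mulrC ler_wpM2r ?Xr // invr_ge0 ler0n.
Qed.

Lemma cvg_expmx_coord (R : realType) n (X : 'M[complex_num R]_n) i j :
  series (fun k => k`!%:R^-1 * (X ^+ k) i j) N @[N --> \oo] --> expmx X i j.
Proof.
have -> : series (fun k => k`!%:R^-1 * (X ^+ k) i j) =
    (fun N => series (fun k => k`!%:R^-1 *: X ^+ k) N i j).
  by apply/funext => N; rewrite /series /= summxE; apply: eq_bigr => k; rewrite mxE.
exact: (continuous_cvg _ (@coord_continuous _ _ _ i j _) (@is_cvg_expmx R _ X)).
Qed.

(** The partial sums at - X and X multiply to 1 plus a corner sum, dominated by the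
    scalar corner sum at c and c, which vanishes in the limit because
    expR (r + r) = expR r * expR r for the real number r behind c. *)
Lemma expmxNK (R : realType) n (X : 'M[complex_num R]_n) :
  expmx (- X) *m expmx X = 1%:M.
Proof.
(* Square matrices form an algebra only in positive size. *)
case: n X => [|n] X; first by rewrite [LHS]flatmx0 [RHS]flatmx0.
pose S (Y : 'M[complex_num R]_n.+1) N : 'M[complex_num R]_n.+1 := exp_trunc Y N.
have entry Y i j : S Y N i j @[N --> \oo] --> expmx Y i j.
  have -> : (fun N => S Y N i j) = series (fun k => k`!%:R^-1 * (Y ^+ k) i j).
    apply/funext => N; rewrite /S /exp_trunc /series /= summxE big_mkord.
    by apply: eq_bigr => k _; rewrite mxE.
  exact: cvg_expmx_coord.
have prod_cvg i j : (S (- X) N * S X N) i j @[N --> \oo] -->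
    (expmx (- X) *m expmx X) i j.
  under eq_fun do rewrite -mulmxE mxE.
  rewrite mxE; apply: cvg_big; first exact: add_continuous.
  by move=> k _; apply: cvgM; exact: entry.
suff prod_cvg1 i j : (S (- X) N * S X N) i j @[N --> \oo] -->
    (1%:M : 'M[complex_num R]_n.+1) i j.
  apply/matrixP => i j.
  exact: (cvg_unique (@norm_hausdorff _ _) (prod_cvg i j) (prod_cvg1 i j)).
have [c] := expr_mx_bound X.
case: c => r r'; rewrite lecE /= => /andP[/eqP -> r0] Xr.
pose c : (complex_num R)^o := creal r.
(* By [exp_trunc_mul] this is the corner sum at c and c. *)
pose tail N : complex_num R := exp_trunc c N * exp_trunc c N - exp_trunc (c + c) N.
have tail0 : tail N @[N --> \oo] --> (0 : complex_num R).
  have -> : (0 : complex_num R) = creal (expR r) * creal (expR r)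
      - creal (expR (r + r)).
    by rewrite expRD rmorphM subrr.
  apply: cvgB; first by apply: cvgM; exact: cvg_exp_trunc_complex.
  by rewrite /c -rmorphD; exact: cvg_exp_trunc_complex.
(* The partial sum of order 0 is 0 and not 1: from order 1 on, the partial sums
   at - X + X = 0 are equal to 1. *)
have shift (u : nat -> complex_num R) (l : complex_num R) :
    (u N.+1 @[N --> \oo] --> l) = (u N @[N --> \oo] --> l).
  exact: (@cvg_shiftS (complex_num R) u (nbhs l)).
have tailS : tail N.+1 @[N --> \oo] --> (0 : complex_num R).
  by rewrite (shift tail).
pose p N : complex_num R := (S (- X) N * S X N) i j.
suff pS : p N.+1 @[N --> \oo] -->
    ((1%:M : 'M[complex_num R]_n.+1) i j : complex_num R).
  by rewrite (shift p) in pS.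
apply: (iffLR (@subr_cvg0 (complex_num R) (complex_num R) nat
  \oo _ (fun N => p N.+1) _)).
apply: (norm_dominated_cvg0 _ tailS) => N.
rewrite /p /tail /S.
have XX : GRing.comm (- X) X by apply/commr_sym/commrN.
have cc : GRing.comm c c by [].
rewrite (exp_trunc_mul _ XX) (exp_trunc_mul _ cc) addNr mxE.
have -> : exp_trunc (0 : 'M[complex_num R]_n.+1) N.+1 = 1.
  rewrite /exp_trunc big_ord_recl /= expr0 fact0 invr1 scale1r big1 ?addr0//.
  by move=> k _; rewrite expr0n scaler0.
rewrite ![_ + _ - _]addrAC !subrr !add0r summxE (le_trans (ler_norm_sum _ _ _)) //.
apply: ler_sum => a _; rewrite summxE (le_trans (ler_norm_sum _ _ _)) //.
apply: ler_sum => b _; rewrite mxE normrM.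
have w0 : 0 <= (a`!%:R^-1 / b`!%:R : complex_num R) by rewrite divr_ge0 ?invr_ge0.
rewrite (ger0_norm w0); apply: ler_wpM2l => //.
rewrite exprNn -signr_odd -mulrA -!exprD mulr_sign.
by case: (odd a); rewrite ?[(- _ : 'M[_]_(_, _)) _ _]mxE ?normrN; exact: Xr.
Qed.

Lemma expmx_tr (R : realType) n (X : 'M[complex_num R]_n) :
  expmx X^T = (expmx X)^T.
Proof.
have trX k : X^T ^+ k = (X ^+ k)^T.
  by elim: k => [|k IHk]; rewrite ?expr0 ?trmx1 //
    exprS exprSr IHk -!mulmxE trmx_mul.
apply/matrixP => i j; rewrite mxE.
have tr_coord := @cvg_expmx_coord R n X^T i j.
have coordE : (fun k => k`!%:R^-1 * (X^T ^+ k) i j) =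
    (fun k => k`!%:R^-1 * (X ^+ k) j i) by apply/funext => k; rewrite trX mxE.
rewrite coordE in tr_coord.
exact: (cvg_unique (@norm_hausdorff _ _) tr_coord (@cvg_expmx_coord R n X j i)).
Qed.

Lemma expmx_skew_orthogonal (R : realType) n (X : 'M[R[i]]_n) :
  X^T = - X -> (expmx X)^T *m expmx X = 1%:M.
Proof. by move=> XT; rewrite -expmx_tr XT expmxNK. Qed.

Local Close Scope classical_set_scope.

(** * The weighted lifts and their two Gram products *)

Definition weighted_lifts (R : realType) M L (w : 'I_L -> R)
    (pi_ : 'I_L -> 'cV[R]_M) (nu : 'cV[R]_M) : 'M[R]_(M, L) :=
  \matrix_(i, l) (Num.sqrt (w l) * normalised_lift nu (pi_ l) i 0).

Lemma register_mixtureE (R : realType) M L (w : 'I_L -> R)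
    (pi_ : 'I_L -> 'cV[R]_M) (nu : 'cV[R]_M) :
  (forall l, 0 <= w l) ->
  register_mixture w pi_ nu =
  weighted_lifts w pi_ nu *m (weighted_lifts w pi_ nu)^T.
Proof.
move=> w0; apply/matrixP => i j; rewrite summxE mxE; apply: eq_bigr => l _.
rewrite [LHS]mxE mxE big_ord1 !mxE.
by rewrite [RHS]mulrACA -expr2 sqr_sqrtr.
Qed.

Lemma weighted_overlap_matrixE (R : realType) M L (w : 'I_L -> R)
    (pi_ : 'I_L -> 'cV[R]_M) (nu : 'cV[R]_M) :
  weighted_overlap_matrix w pi_ nu =
  (weighted_lifts w pi_ nu)^T *m weighted_lifts w pi_ nu.
Proof.
apply/matrixP => l m; rewrite /weighted_overlap_matrix mul_diag_mx mul_mx_diag.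
rewrite !mxE /chi2_overlap /inner invfM mulr_suml mulr_sumr mulr_suml.
apply: eq_bigr => i _; rewrite !mxE /=.
ring.
Qed.

(** * Orthogonality of the flow and conservation *)

Lemma sqrt_diag_unitmx (R : realType) M (nu : 'cV[R]_M) :
  (forall i, 0 < nu i 0) -> sqrt_diag nu \in unitmx.
Proof.
move=> nu0; rewrite unitmxE det_diag unitfE; apply/prodf_neq0 => i _.
by rewrite mxE gt_eqF // sqrtr_gt0.
Qed.

(** Detailed balance says that D^2 P = P^T D^2 for D = sqrt_diag nu, which is the
    symmetry of D P D^-1 after multiplying by D on both sides. *)
Lemma symmetrised_tr (R : realType) M (Q : 'M[R]_M) (Lambda : R) (nu : 'cV[R]_M) :
  (forall i, 0 < nu i 0) -> is_reversible Q nu ->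
  (symmetrised Q Lambda nu)^T = symmetrised Q Lambda nu.
Proof.
move=> nu0 hrev; rewrite /symmetrised; set P := uniformised Q Lambda.
have uD := sqrt_diag_unitmx nu0.
have trD : (sqrt_diag nu)^T = sqrt_diag nu by rewrite tr_diag_mx.
have balance : sqrt_diag nu *m (sqrt_diag nu *m P) =
    P^T *m sqrt_diag nu *m sqrt_diag nu.
  apply/matrixP => i j; rewrite !mul_diag_mx !mul_mx_diag !mxE.
  rewrite mulrA mulrDr -[RHS]mulrA mulrDl -!expr2 !sqr_sqrtr ?ltW //.
  congr (_ + _); last by rewrite mulrCA hrev [RHS]mulrC mulrCA.
  by case: (eqVneq i j) => [->|]; rewrite ?eqxx ?mulr1 ?mul1r // mulr0 mul0r.
rewrite !trmx_mul trmx_inv trD mulmxA.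
apply: (can_inj (mulKmx uD)); rewrite !mulmxA mulmxV // mul1mx.
by rewrite -(mulmxA (sqrt_diag nu)) balance mulmxK.
Qed.

(** Transposing swaps the off-diagonal blocks - iA and iA; as A is symmetric this
    is a change of sign. *)
Lemma doubled_generator_tr (R : realType) M (Q : 'M[R]_M) (Lambda : R)
    (nu : 'cV[R]_M) :
  (forall i, 0 < nu i 0) -> is_reversible Q nu ->
  (doubled_generator Q Lambda nu)^T = - doubled_generator Q Lambda nu.
Proof.
move=> nu0 hrev; rewrite /doubled_generator /=.
have : (map_mx (real_complex R) (symmetrised Q Lambda nu))^T =
    map_mx (real_complex R) (symmetrised Q Lambda nu).
  by rewrite matrix.map_trmx symmetrised_tr.
move: (map_mx _ _) => A trA.
by rewrite tr_block_mx opp_block_mx !trmx0 !linearN !linearZ /= trA opprK !oppr0.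
Qed.

(** Skewness for the plain transpose survives multiplication by any complex scalar,
    so orthogonality holds at every z, including real z, where the flow is the
    exponential of a Hermitian matrix and need not be unitary. *)
Lemma wave_flow_orthogonal (R : realType) M (Q : 'M[R]_M) (Lambda : R)
    (nu : 'cV[R]_M) z :
  (forall i, 0 < nu i 0) -> is_reversible Q nu ->
  (wave_flow Q Lambda nu z)^T *m wave_flow Q Lambda nu z = 1%:M.
Proof.
move=> nu0 hrev; apply: expmx_skew_orthogonal.
by rewrite linearZ /= doubled_generator_tr // scalerN.
Qed.

(** Every component is carried by the same flow, so W factors out of the sum of
    rank-one terms on both sides; rho is the mixture of the lifts before the flow
    acts, chosen once for all z. *)
Lemma doubled_mixture_conj (R : realType) M L (w : 'I_L -> R)
    (pi_ : 'I_L -> 'cV[R]_M) (Q : 'M[R]_M) (Lambda : R) (nu : 'cV[R]_M) :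
  (forall i, 0 < nu i 0) -> is_reversible Q nu ->
  exists rho : 'M[R[i]]_(M + M), forall z, exists2 W : 'M[R[i]]_(M + M),
    W^T *m W = 1%:M &
    doubled_mixture w pi_ Q Lambda nu z = W *m rho *m W^T.
Proof.
move=> nu0 hrev.
pose phi l : 'cV[R[i]]_(M + M) :=
  col_mx (map_mx (real_complex R) (normalised_lift nu (pi_ l))) 0.
exists (\sum_l real_complex R (w l) *: (phi l *m (phi l)^T)) => z.
exists (wave_flow Q Lambda nu z); first exact: wave_flow_orthogonal.
rewrite mulmx_sumr mulmx_suml; apply: eq_bigr => l _.
by rewrite -scalemxAr -scalemxAl trmx_mul !mulmxA.
Qed.

Theorem theorem8p4 (R : realType) (M : nat) (Q : 'M[R]_M) (nu : 'cV[R]_M)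
    (Lambda : R) (L : nat) (w : 'I_L -> R) (pi_ : 'I_L -> 'cV[R]_M)
    (hM : (2 <= M)%N)
    (hQ : is_generator Q) (hirr : irreducible_generator Q)
    (hnu : is_stationary Q nu) (hnu0 : forall i, 0 < nu i 0)
    (hrev : is_reversible Q nu)
    (hLambda0 : 0 < Lambda) (hLambda : forall i, - Q i i <= Lambda)
    (hw0 : forall l, 0 <= w l) (hw1 : \sum_l w l = 1)
    (hpi : forall l, is_law (pi_ l)) :
  same_nonzero_spectrum
    (map_mx (real_complex R) (register_mixture w pi_ nu))
    (map_mx (real_complex R) (weighted_overlap_matrix w pi_ nu)) /\
  (forall z : R[i],
     char_poly (doubled_mixture w pi_ Q Lambda nu z) =
     char_poly (doubled_mixture w pi_ Q Lambda nu 0)) /\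
  (forall (k : nat) (z : R[i]), (1 <= k)%N ->
     \tr (doubled_mixture w pi_ Q Lambda nu z ^+ k) =
     \tr (doubled_mixture w pi_ Q Lambda nu 0 ^+ k)).
Proof.
have [rho rhoE] := @doubled_mixture_conj R M L w pi_ Q Lambda nu hnu0 hrev.
split; last split.
- rewrite register_mixtureE // weighted_overlap_matrixE !map_mxM.
  exact: same_nonzero_spectrum_mulmxC.
- have charE z : char_poly (doubled_mixture w pi_ Q Lambda nu z) = char_poly rho.
    by have [W WW ->] := rhoE z; exact: char_poly_conj.
  by move=> z; transitivity (char_poly rho); rewrite charE.
- move=> k z _.
  have traceE x : \tr (doubled_mixture w pi_ Q Lambda nu x ^+ k) = \tr (rho ^+ k).
    by have [W WW ->] := rhoE x; exact: mxtrace_expr_conj.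
  by transitivity (\tr (rho ^+ k)); rewrite traceE.
Qed.
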